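(* Let $(X,\mathcal T)$ be a topological space. The following are equivalent: (1) the approach space $(X,\delta_{\mathcal T})$ satisfies Tietze's extension theorem for contractions (as defined in the context); (2) $(X,\mathcal T)$ satisfies the classical topological Tietze theorem for continuous maps: every real-valued continuous map defined on a closed subspace of $X$ has a continuous real-valued extension to all of $X$.
   Context: A distance on a set $X$ is a function $\delta:X\times 2^X\to[0,\infty]$ such that for all $x\in X$, $A,B\subseteq X$, $\varepsilon\in[0,\infty]$: (D1) $\delta(x,\{x\})=0$; (D2) $\delta(x,\emptyset)=\infty$; (D3) $\delta(x,A\cup B)=\min\{\delta(x,A),\delta(x,B)\}$; (D4) $\delta(x,A)\le\delta(x,A^{(\varepsilon)})+\varepsilon$, where $A^{(\varepsilon)}=\{x\in X\mid\delta(x,A)\le\varepsilon\}$. The pair $(X,\delta)$ is an approach space. A map $f:(X,\delta_X)\to(Y,\delta_Y)$ is a contraction if $\delta_Y(f(x),f(A))\le\delta_X(x,A)$ for all $x\in X$, $A\subseteq X$. A subset $Y\subseteq X$ carries the restricted distance, still denoted $\delta$. For a topology $\mathcal T$ on $X$, the associated distance is $\delta_{\mathcal T}(x,A)=0$ if $x\in\mathrm{cl}\,A$ and $\infty$ otherwise. For a metric $d$, $\delta_d(z,A)=\inf_{a\in A}d(z,a)$; $d_{\mathbb E}(x,y)=|x-y|$. For $A\subseteq X$ write $\delta_A(x)=\delta(x,A)$. For $M\subseteq Y$ let $\theta_M:Y\to[0,\infty]$ be $0$ on $M$ and $\infty$ on $Y\setminus M$. A development of a bounded function $f:Y\to[0,\infty]$,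 indexed by $0<\varepsilon<1$, is a family of functions $\mu_\varepsilon=\bigwedge_{i=1}^{n(\varepsilon)}(m_i^\varepsilon+\theta_{M_i^\varepsilon})$ on $Y$ (pointwise minimum), where for each $\varepsilon$ the finite family $(M_i^\varepsilon)_{i=1}^{n(\varepsilon)}$ is a partition of $Y$ and $m_i^\varepsilon\in[0,\infty[$, such that $\mu_\varepsilon\le f\le\mu_\varepsilon+\varepsilon$ for every $\varepsilon\in\,]0,1[$. Tietze's extension theorem for contractions on $(X,\delta)$: for every $Y\subseteq X$, every $\gamma\in[0,\infty[$ and every contraction $f:(Y,\delta)\to([0,\gamma],\delta_{d_{\mathbb E}})$ having a development $\left(\mu_\varepsilon=\bigwedge_{i=1}^{n(\varepsilon)}(m_i^\varepsilon+\theta_{M_i^\varepsilon})\right)_{0<\varepsilon<1}$ such that for all $x\in X\setminus Y$, all $\varepsilon\in\,]0,1[$ and all $1\le l,k\le n(\varepsilon)$, $$m_l^\varepsilon-m_k^\varepsilon\le\delta_{M_k^\varepsilon}(x)+\delta_{M_l^\varepsilon}(x),$$ there exists a contraction $g:(X,\delta)\to([0,\gamma],\delta_{d_{\mathbb E}})$ with $g|_Y=f$. *)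

(* Defs.v *)
From HB Require Import structures.
From mathcomp Require Import all_boot all_order all_algebra.
From mathcomp Require Import all_classical all_reals all_analysis.

Set Implicit Arguments.
Unset Strict Implicit.
Unset Printing Implicit Defensive.

Import Order.TTheory GRing.Theory Num.Theory numFieldNormedType.Exports.

Local Open Scope classical_set_scope.
Local Open Scope ring_scope.
Local Open Scope ereal_scope.

(* [dist_ge0] expresses that the values lie in [0, +oo]; in [dist_enlarge] the
   set [[set y | delta y A <= e]] is the enlargement A^(e). *)
Record is_distance (R : realType) (X : Type) (delta : X -> set X -> \bar R)
    : Prop := IsDistance {
  dist_ge0 : forall x A, 0 <= delta x A ;
  dist_self : forall x, delta x [set x] = 0 ;
  dist_set0 : forall x, delta x set0 = +oo ;
  dist_setU : forall x A B,
    delta x (A `|` B) = Order.min (delta x A) (delta x B) ;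
  dist_enlarge : forall x A (e : \bar R), 0 <= e ->
    delta x A <= delta x [set y | delta y A <= e] + e
}.

(* An approach space is a type [X] together with a [distance R X]. *)
Record distance (R : realType) (X : Type) := Distance {
  distance_fun :> X -> set X -> \bar R ;
  distanceP : is_distance distance_fun
}.

Definition app_contraction (R : realType) (X Y : Type)
    (dX : distance R X) (dY : distance R Y) (f : X -> Y) : Prop :=
  forall x A, dY (f x) (f @` A) <= dX x A.

Definition restr_dist (R : realType) (X : Type) (delta : distance R X)
    (Y : set X) (y : Y) (A : set Y) : \bar R :=
  delta (val y) [set val a | a in A].

Lemma restr_dist_is_distance (R : realType) (X : Type) (delta : distance R X)
  (Y : set X) : is_distance (@restr_dist R X delta Y).
Proof.
have [h0 h1 h2 h3 h4] := distanceP delta.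
rewrite /restr_dist; split.
- by move=> *; exact: h0.
- by move=> x; rewrite image_set1 h1.
- by move=> x; rewrite image_set0 h2.
- by move=> x A B; rewrite image_setU h3.
- move=> x A e e0; apply: (le_trans (h4 (val x) _ _ e0)).
  apply: leeD2r.
  have sub : [set val y | y in
      [set y : Y | delta (val y) [set val a | a in A] <= e]] `<=`
      [set y | delta y [set val a | a in A] <= e].
    by move=> _ [y /= ye <-].
  by rewrite -((setUidPr _ _).2 sub) h3 ge_min lexx.
Qed.

Definition restriction (R : realType) (X : Type) (delta : distance R X)
    (Y : set X) : distance R Y :=
  Distance (restr_dist_is_distance delta Y).

Definition top_dist (R : realType) (X : topologicalType) (x : X) (A : set X)
    : \bar R :=
  if x \in closure A then 0 else +oo.

Lemma top_dist_is_distance (R : realType) (X : topologicalType) :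
  is_distance (@top_dist R X).
Proof.
rewrite /top_dist; split.
- by move=> x A; case: ifP.
- by move=> x; rewrite mem_set//; exact: subset_closure.
- by move=> x; rewrite closure0 in_set0.
- move=> x A B; rewrite closureU in_setU.
  case: (x \in closure A) => /=.
    by rewrite min_l//; case: ifP.
  by rewrite min_r// leey.
- move=> x A [r| |//] r0; last first.
    by rewrite addey; [exact: leey|case: ifP].
  case: ifPn => xA.
    by apply: adde_ge0 => //; case: ifP.
  suff -> : [set y | (if y \in closure A then 0 else +oo) <= r%:E] = closure A.
    by rewrite -(closure_id _).1 ?(negbTE xA)//; exact: closed_closure.
  apply/seteqP; split => y /=; last by move=> yA; rewrite mem_set.
  by case: ifPn => [/set_mem//|_]; rewrite leye_eq.
Qed.

Definition top_distance (R : realType) (X : topologicalType) : distance R X :=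
  Distance (@top_dist_is_distance R X).

Definition metric_dist (R : realType) (M : metricType R) (x : M) (A : set M)
    : \bar R :=
  ereal_inf [set (mdist x a)%:E | a in A].

Lemma metric_dist_is_distance (R : realType) (M : metricType R) :
  is_distance (@metric_dist R M).
Proof.
have ge0 (x : M) A : 0 <= metric_dist x A.
  by apply: le_ereal_inf_tmp => _ [a _ <-]; rewrite lee_fin mdist_ge0.
rewrite /metric_dist; split.
- exact: ge0.
- by move=> x; rewrite image_set1 ereal_inf1 mdistxx.
- by move=> x; rewrite image_set0 ereal_inf0.
- move=> x A B; rewrite image_setU; apply/eqP; rewrite eq_le; apply/andP; split.
    by rewrite le_min; apply/andP; split; apply: ereal_inf_le_tmp => y; [left|right].
  apply: le_ereal_inf_tmp => y [] yAB; rewrite ge_min; apply/orP; [left|right];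
    exact: ereal_inf_lbound.
- move=> x A [r| |//] r0; last first.
    rewrite addey ?leey// -ltNye; apply: lt_le_trans (ge0 _ _).
    exact: ltNy0.
  rewrite -leeBlDr//; apply: le_ereal_inf_tmp => _ [b /= br <-].
  rewrite EFinN leeBlDr// -EFinD; apply/lee_addgt0Pr => e e0.
  have /ereal_inf_lt [_ [a Aa <-]] :
      ereal_inf [set (mdist b a)%:E | a in A] < (r + e)%:E.
    by apply: le_lt_trans br _; rewrite lte_fin ltrDl.
  rewrite lte_fin => bae; apply: (@le_trans _ _ (mdist x a)%:E).
    by apply: ereal_inf_lbound; exists a.
  rewrite -EFinD lee_fin (le_trans (metric_triangle x b a))//.
  by rewrite -addrA lerD2l ltW.
Qed.

Definition metric_distance (R : realType) (M : metricType R) : distance R M :=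
  Distance (@metric_dist_is_distance R M).

(* The library puts the metric (x, y) |-> `|y - x| on [R^o]. *)
Definition euclidean_distance (R : realType) : distance R R :=
  metric_distance R^o.

Lemma euclidean_distanceE (R : realType) (x : R) (A : set R) :
  euclidean_distance R x A = ereal_inf [set `|x - a|%:E | a in A].
Proof.
by congr ereal_inf; apply: eq_imagel => a _; rewrite distrC.
Qed.

Definition interval_distance (R : realType) (gamma : R)
    : distance R `[0%R, gamma]%classic :=
  restriction (euclidean_distance R) `[0%R, gamma]%classic.

Definition theta (R : realType) (Y : Type) (M : set Y) (y : Y) : \bar R :=
  if y \in M then 0 else +oo.

(* The data are indexed by all of [R] but only constrained on ]0, 1[; the
   blocks M^e_i are subsets of the (sub)type [Y] on which [f] is defined. *)
Record development (R : realType) (Y : Type) (f : Y -> \bar R) := Development {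
  dev_size : R -> nat ;
  dev_val : forall e : R, 'I_(dev_size e) -> R ;
  dev_set : forall e : R, 'I_(dev_size e) -> set Y ;
  dev_fun := fun (e : R) (y : Y) =>
    \big[Order.min/+oo]_(i < dev_size e)
      ((dev_val i)%:E + theta R (dev_set i) y) ;
  dev_partition : forall e : R, (0 < e < 1)%R ->
    partition [set: 'I_(dev_size e)] (@dev_set e) [set: Y] ;
  dev_val_ge0 : forall e : R, (0 < e < 1)%R ->
    forall i : 'I_(dev_size e), (0 <= dev_val i)%R ;
  dev_le : forall e : R, (0 < e < 1)%R ->
    forall y, dev_fun e y <= f y <= dev_fun e y + e%:E
}.

Definition tietze_contractions (R : realType) (X : Type)
    (delta : distance R X) : Prop :=
  forall (Y : set X) (gamma : R) (f : Y -> `[0%R, gamma]%classic),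
    (0 <= gamma)%R ->
    app_contraction (restriction delta Y) (interval_distance gamma) f ->
    (exists D : development (fun y => (val (f y))%:E),
      forall (x : X), ~ Y x ->
      forall e : R, (0 < e < 1)%R ->
      forall l k : 'I_(dev_size D e),
        (dev_val l - dev_val k)%:E <=
        delta x [set val y | y in dev_set k] +
        delta x [set val y | y in dev_set l]) ->
    exists g : X -> `[0%R, gamma]%classic,
      app_contraction delta (interval_distance gamma) g /\
      forall y : Y, g (val y) = f y.

(* [A : set X], used as a type, carries the subspace topology. *)
Definition tietze_continuous (R : realType) (X : topologicalType) : Prop :=
  forall (A : set X) (f : A -> R), closed A -> continuous f ->
    exists g : X -> R, continuous g /\ forall a : A, g (val a) = f a.

(* Main.v *)
Require Import Defs.
From mathcomp Require Import all_boot all_order all_algebra.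
From mathcomp Require Import all_classical all_reals all_analysis.
From mathcomp Require Import ring lra.

(** For the distance of a topology, a contraction into [[0, gamma]] is the same
    thing as a continuous map: both say that the image of a closure point of
    [A] is a closure point of the image of [A]
    ([top_dist_euclidean_contractionP]). The distance only takes the values [0]
    and [+oo], so the inequality imposed on a development at a point [x] outside
    [Y] says that two blocks adherent to [x] carry the same value.

    From continuous maps to contractions, the domain [Y] need not be closed.
    At a point [x] of the closure of [Y] outside [Y], a neighbourhood of [x]
    meets only those blocks that are adherent to [x], and these all carry one
    value; so [f] oscillates by at most [e] near [x]
    ([development_oscillation]), for every [e]. Hence [f] has a limit at every
    point of the closure of [Y], and because the real line is regular these
    limits form a continuous function on the closure
    ([within_cvg_closure_continuous]). The classical theorem extends that
    function to the whole space, and clamping brings it back into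
    [[0, gamma]].

    From contractions to continuous maps, let [A] be closed. A point outside
    [A] is at distance [+oo] from every subset of [A], so the condition on the
    development is void, and a bounded function always has a development, by
    rounding its values down to multiples of [e] ([bounded_development]). This
    gives the classical theorem for bounded functions
    ([tietze_contractions_bounded]). The unbounded case follows by squeezing
    the line into [(-1, 1)] and keeping the extension away from [-1] and [1]
    ([tietze_unbounded]). *)

Set Implicit Arguments.
Unset Strict Implicit.
Unset Printing Implicit Defensive.

Import Order.TTheory GRing.Theory Num.Theory numFieldNormedType.Exports.

Local Open Scope classical_set_scope.
Local Open Scope ring_scope.

(** * Contractions for the distance of a topology *)

Lemma continuous_closureP (S T : topologicalType) (f : S -> T) :
  continuous f <-> forall x A, closure A x -> closure (f @` A) (f x).
Proof.
split=> [cf x A clAx B /cf /clAx[y [Ay By]]|clf].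
  by exists (f y); split => //; exists y.
apply/continuous_closedP => B cB x /clf fx; apply: cB.
by apply: (@closureS _ (f @` (f @^-1` B))) fx => _ [y By <-].
Qed.

Lemma closure_image_val (X : topologicalType) (Y : set X) (A : set Y) (y : Y) :
  closure [set val a | a in A] (val y) <-> closure A y.
Proof.
split=> [clA B [_ [[W oW <-]] /= Wy sWB]|clA B nB].
  have [_ [[a Aa <-] Wa]] := clA W (open_nbhs_nbhs (conj oW Wy)).
  by exists a; split => //; exact: sWB.
have [a [Aa Ba]] := clA _ (@initial_continuous Y X set_val y _ nB).
by exists (val a); split => //; exists a.
Qed.

Lemma euclidean_distance_le0 (R : realType) (x : R) (A : set R) :
  (euclidean_distance R x A <= 0)%E <-> closure A x.
Proof.
rewrite euclidean_distanceE; split=> [infA B /nbhs_ballP[e /= e0 xeB]|clA].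
  have /ereal_inf_lt[_ [a Aa <-]] :
      (ereal_inf [set `|x - a|%:E | a in A] < e%:E)%E.
    by apply: le_lt_trans infA _; rewrite lte_fin.
  by rewrite lte_fin => xae; exists a; split => //; exact: xeB.
apply/lee_addgt0Pr => e e0; rewrite add0e.
have [a [Aa xae]] := clA _ (nbhsx_ballx x e e0).
apply: (@le_trans _ _ `|x - a|%:E); first by apply: ereal_inf_lbound; exists a.
by rewrite lee_fin; exact: ltW xae.
Qed.

(** The space [T] is kept apart from the distance [delta] because on
    a subspace the restricted distance and the distance of the subspace topology
    are two different records with equal values. *)
Lemma top_dist_euclidean_contractionP (R : realType) (T : topologicalType)
    (delta : distance R T) (gamma : R) (f : T -> `[0, gamma]%classic) :
    (forall x A, delta x A = top_dist R x A) ->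
  app_contraction delta (interval_distance gamma) f <->
  continuous (fun x => val (f x) : R).
Proof.
move=> deltaE; rewrite continuous_closureP.
have eucl x A : (interval_distance gamma (f x) (f @` A) <= 0)%E <->
    closure ((fun y => val (f y) : R) @` A) (val (f x)).
  by rewrite -euclidean_distance_le0 /= /restr_dist image_comp.
split=> [cf x A clA|cf x A].
  by apply/eucl; rewrite (le_trans (cf x A))// deltaE /top_dist mem_set.
rewrite deltaE /top_dist; case: ifPn => [/set_mem /cf /eucl //|_].
exact: leey.
Qed.

Lemma restriction_top_distanceE (R : realType) (X : topologicalType)
    (Y : set X) (y : Y) (A : set Y) :
  restriction (top_distance R X) Y y A = top_dist R y A.
Proof.
rewrite /= /restr_dist /= /top_dist; congr (if _ then _ else _).
by apply/idP/idP => /set_mem h; apply/mem_set; apply/closure_image_val.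
Qed.

(** * Extension to the closure *)

(** The regularity of the line is used through its closed balls: a
    neighbourhood on which [f] is [e]-close to [g x] also forces its limits [g w]
    at nearby points [w] to be [e]-close to [g x]. *)
Lemma within_cvg_closure_continuous (X : topologicalType) (R : realType)
    (Y : set X) (f g : X -> R) :
  (forall x, closure Y x -> f @ within Y (nbhs x) --> g x) ->
  {within closure Y, continuous g}.
Proof.
move=> fg; apply/subspace_continuousP => x clYx.
apply/cvgrPdist_le => e e0.
have := fg x clYx; move/cvgrPdist_le => /(_ e e0) /nbhs_interior.
rewrite /prop_near1 /within /=; apply: filterS => w nw clYw.
have ? : ProperFilter (within Y (nbhs w)) by exact: within_nbhs_proper.
apply: (@closed_cvg _ _ (within Y (nbhs w)) _ f (fun t => `|g x - t| <= e)) (fg w clYw) => //.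
exact: closed_closed_ball_.
Qed.

(** * Developments *)

Lemma bigmin_theta (R : realType) (Y : Type) (n : nat) (m : 'I_n -> R)
    (M : 'I_n -> set Y) (i : 'I_n) (y : Y) :
  trivIset [set: 'I_n] M -> M i y ->
  (\big[Order.min/+oo]_(j < n) ((m j)%:E + theta R (M j) y) = (m i)%:E)%E.
Proof.
move=> tM Miy; rewrite (bigD1 i)//= /theta (mem_set Miy) adde0.
rewrite big1 ?min_l ?leey// => j ji; case: ifPn => [/set_mem Mjy|_]; last exact: addey.
by case/eqP: ji; apply: tM => //; exists y.
Qed.

(** A partition has nonempty blocks, so the fibres have to be reindexed by the
    values that [c] takes. *)
Lemma fibers_partition (Y : Type) (I : finType) (c : Y -> I)
    (P := [pred i | `[< exists y, c y = i >]]) :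
  partition [set: 'I_#|P|] (fun j => [set y | c y = enum_val j]) [set: Y].
Proof.
split.
- apply/seteqP; split => // y _.
  have Py : c y \in P by apply: asboolT; exists y.
  by exists (enum_rank_in Py (c y)) => //=; rewrite enum_rankK_in.
- by move=> i j _ _ [y [/= cyi cyj]]; apply: enum_val_inj; rewrite -cyi -cyj.
- move=> j _; have := enum_valP j.
  by move=> /asboolW[y cy]; exists y.
Qed.

(** Rounding [f] down to a multiple of [e] takes finitely many values because
    [f] is bounded, and changes [f] by at most [e]. *)
Lemma bounded_development (R : realType) (Y : Type) (gamma : R) (f : Y -> R) :
  (forall y, 0 <= f y <= gamma) -> development (fun y => (f y)%:E).
Proof.
move=> f01.
pose N (e : R) := Num.truncn (gamma / e).
pose c e y : 'I_(N e).+1 := inord (Num.truncn (f y / e)).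
pose P e := [pred i | `[< exists y, c e y = i >]].
have part e := fibers_partition (c e).
have tc e y : 0 < e ->
    (c e y)%:R * e <= f y < (c e y)%:R * e + e.
  move=> e0; have /andP[fy0 fyg] := f01 y.
  have {}fyg : f y / e <= gamma / e by rewrite ler_pM2r ?invr_gt0.
  have {}fy0 : 0 <= f y / e by rewrite divr_ge0// ltW.
  rewrite /c inordK; last by rewrite ltnS; exact: le_truncn.
  have := truncn_itv fy0; rewrite ler_pdivlMr// ltr_pdivrMr//.
  by rewrite -natr1 mulrDl mul1r.
apply: (@Development R Y _ (fun e => #|P e|)
  (fun e j => (enum_val j : 'I_(N e).+1)%:R * e)
  (fun e j => [set y | c e y = enum_val j])) => [e _|e /andP[e0 _] j|e /andP[e0 _] y].
- exact: part.
- by rewrite mulr_ge0// ltW.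
- have [covP tP _] := part e.
  have [j _ /= cj] : cover [set: 'I_#|P e|] (fun j => [set y | c e y = enum_val j]) y.
    by rewrite covP.
  rewrite (bigmin_theta _ tP cj) -cj -EFinD !lee_fin.
  by have /andP[-> /ltW] := tc e y e0.
Qed.

(** There are finitely many blocks, so some neighbourhood of [x] meets only the
    blocks adherent to [x]. By hypothesis these share a single value [m], and
    [f] is within [e] above the value of the block. *)
Lemma development_oscillation (R : realType) (X : topologicalType)
    (Y : set X) (f : Y -> \bar R) (D : development f) (e : R) (x : X) :
  0 < e < 1 -> closure Y x ->
  (forall l k : 'I_(dev_size D e), ((dev_val l - dev_val k)%:E <=
    top_distance R X x [set val y | y in dev_set k] +
    top_distance R X x [set val y | y in dev_set l])%E) ->
  exists m : R, \forall z \near x,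
    forall y : Y, val y = z -> (m%:E <= f y <= (m + e)%:E)%E.
Proof.
move=> e01 clYx devx; have [covD tD _] := dev_partition D e01.
pose F l := [set val y | y in @dev_set _ _ _ D e l].
have nearF : \forall z \near x, forall l, F l z -> closure (F l) x.
  apply: (@filter_forall _ _ (fun l z => F l z -> closure (F l) x)) => l.
  case: (pselect (closure (F l) x)) => [clx|nclx]; first exact: nearW.
  have : nbhs x (~` closure (F l)).
    by apply: open_nbhs_nbhs; split => //; exact/closed_openC/closed_closure.
  by apply: filterS => z nz Fz; case: nz; exact: subset_closure.
have inF (y : Y) : exists2 l, dev_set l y & F l (val y).
  have [l _ ly] : cover [set: 'I_(dev_size D e)] (@dev_set _ _ _ D e) y.
    by rewrite covD.
  by exists l => //; exists y.
have [z [Yz Fz]] := clYx _ nearF.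
have [k _ /Fz clk] := inF (SigSub (mem_set Yz)).
exists (dev_val k); move: nearF; apply: filterS => w Fy y yw; rewrite -{w}yw in Fy.
have [l ly /Fy cll] := inF y.
have td0 i : closure (F i) x -> top_distance R X x (F i) = 0%E.
  by move=> cli; rewrite /= /top_dist mem_set.
have lk : dev_val l = dev_val k.
  have := devx k l; have := devx l k.
  rewrite !td0// adde0 !lee_fin !subr_le0 => lk kl.
  by apply/eqP; rewrite eq_le lk kl.
have := dev_le D e01 y; rewrite /dev_fun (bigmin_theta _ tD ly).
by rewrite lk EFinD.
Qed.

(** * From continuous maps to contractions *)

(** Working with functions on [X] that are continuous within [A] avoids the
    subtype in the definition. *)
Lemma tietze_continuousP (R : realType) (X : topologicalType) :
  tietze_continuous R X <->
  forall (A : set X) (f : X -> R), closed A -> {within A, continuous f} ->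
    exists g : X -> R, continuous g /\ {in A, g =1 f}.
Proof.
split=> [tX A f cA /subspace_sigL_continuousP cf|tX A f cA cf].
  have [g [cg gf]] := tX A _ cA cf; exists g; split => // x xA.
  by have := gf (SigSub xA); rewrite sigLE.
have fE : sigL A ('valL_ 0 f) = f by exact: valLK.
have [|g [cg gf]] := tX A ('valL_ 0 f) cA.
  by apply/subspace_sigL_continuousP; rewrite fE.
exists g; split => // a; rewrite gf; last exact: valP.
by rewrite -[in RHS]fE.
Qed.

Lemma interval_extension (R : realType) (X : topologicalType) (Y : set X)
    (gamma : R) (f : Y -> `[0, gamma]%classic) (g : X -> R) :
  0 <= gamma -> continuous g -> (forall y, g (val y) = val (f y)) ->
  exists h : X -> `[0, gamma]%classic,
    continuous (fun x => val (h x) : R) /\ forall y, h (val y) = f y.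
Proof.
move=> gamma0 cg gf; pose clamp t : R := Num.max 0 (Num.min t gamma).
have clampP t : clamp t \in `[0, gamma]%classic.
  by rewrite inE /= in_itv /= le_max lexx ge_max gamma0 ge_min lexx orbT.
exists (fun x => SigSub (clampP (g x))); split => [x /=|y].
  apply: (@continuous_max _ _ (cst 0) (g \min cst gamma)); first exact: cst_continuous.
  by apply: continuous_min; [exact: cg|exact: cst_continuous].
apply: val_inj; rewrite /= gf /clamp; have := valP (f y).
by rewrite inE /= in_itv /= => /andP[f0 fg]; rewrite min_l// max_r.
Qed.

Lemma tietze_continuous_contractions (R : realType) (X : topologicalType) :
  tietze_continuous R X -> tietze_contractions (top_distance R X).
Proof.
move=> /tietze_continuousP tX Y gamma f gamma0 cf [D devD].
have {}cf : continuous (fun y => val (f y) : R).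
  exact/(top_dist_euclidean_contractionP _ (@restriction_top_distanceE R X Y)).
pose F : X -> R := 'valL_ 0 (fun y => val (f y)).
have FE : sigL Y F = fun y => val (f y) by exact: valLK.
have FfE y : F (val y) = val (f y) by rewrite -[RHS]/((fun y => val (f y)) y) -FE.
have cF : forall x, Y x -> F @ within Y (nbhs x) --> F x.
  by apply/subspace_continuousP/subspace_sigL_continuousP; rewrite FE.
have limF x : closure Y x -> cvg (F @ within Y (nbhs x)).
  move=> clYx; case: (pselect (Y x)) => [Yx|nYx]; first exact: cvgP (cF x Yx).
  apply/cauchy_cvgP/cauchy_exP => e e0.
  (* A development constrains [f] only for indices below 1. *)
  pose e' := Num.min (e / 2) (1 / 2).
  have e'01 : 0 < e' < 1.
    by rewrite /e' lt_min gt_min; apply/andP; split; [apply/andP|apply/orP; right]; lra.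
  have e'e : e' < e by rewrite /e' gt_min; apply/orP; left; lra.
  have [m nm] := development_oscillation e'01 clYx (devD x nYx e' e'01).
  exists m; rewrite /nbhs /= /within /=; move: nm; apply: filterS => z fz Yz.
  have := fz (SigSub (mem_set Yz)) erefl; rewrite -FfE !lee_fin /= => /andP[mF Fm].
  by rewrite /ball /= ler0_norm; lra.
pose G (x : X) : R := lim (F @ within Y (nbhs x)).
have [] := tX (closure Y) G (@closed_closure _ Y).
  exact: within_cvg_closure_continuous limF.
move=> g [cg gG].
have gf y : g (val y) = val (f y).
  have Yy : Y (val y) by exact: set_mem (valP y).
  rewrite gG; last by apply/mem_set/subset_closure.
  rewrite -FfE; apply: cvg_lim => //; last exact: cF.
  exact/within_nbhs_proper/subset_closure.
have [h [ch hf]] := interval_extension gamma0 cg gf.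
exists h; split => //; exact/(@top_dist_euclidean_contractionP _ _ (top_distance R X)).
Qed.

(** * From contractions to continuous maps *)

Lemma tietze_contractions_bounded (R : realType) (X : topologicalType)
    (tX : tietze_contractions (top_distance R X))
    (A : set X) (f : X -> R) (gamma : R) :
  closed A -> {within A, continuous f} -> 0 <= gamma ->
  (forall x, 0 <= f x <= gamma) ->
  exists g : X -> R,
    [/\ continuous g, {in A, g =1 f} & forall x, 0 <= g x <= gamma].
Proof.
move=> cA cf gamma0 f0g.
have fP x : f x \in `[0, gamma]%classic by rewrite inE /= in_itv /=.
pose fA (a : A) : `[0, gamma]%classic := SigSub (fP (val a)).
have [||g [cg gf]] := tX A gamma fA gamma0.
- apply/(top_dist_euclidean_contractionP _ (@restriction_top_distanceE R X A)).
  exact/subspace_sigL_continuousP.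
- exists (bounded_development (fun a : A => f0g (val a))).
  move=> x nAx e e01 l k.
  have out (M : set A) : top_distance R X x [set val y | y in M] = +oo%E.
    rewrite /= /top_dist memNset// => clM; apply/nAx/cA.
    by apply: closureS clM => _ [a _ <-]; exact: set_mem (valP a).
  by rewrite !out leey.
have {}cg : continuous (fun x => val (g x) : R).
  exact/(@top_dist_euclidean_contractionP _ _ (top_distance R X)).
exists (fun x => val (g x)); split => // [x xA|x].
  by have -> := gf (SigSub xA).
by have := valP (g x); rewrite inE /= in_itv.
Qed.

(** The function [f] is the composition of [u], with values in [(-1, 1)], and
    the homeomorphism [s |-> s / (1 - |s|)] of [(-1, 1)] onto the line. An
    extension of [u] may reach [-1] or [1] on a closed set [B]; as [B] misses
    [A], it can be multiplied by a function that is [1] on [A] and [0] on [B],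
    which again comes from the bounded case. *)
Lemma tietze_unbounded (R : realType) (X : topologicalType) :
  (forall (A : set X) (f : X -> R) (gamma : R),
    closed A -> {within A, continuous f} -> 0 <= gamma ->
    (forall x, 0 <= f x <= gamma) ->
    exists g : X -> R,
      [/\ continuous g, {in A, g =1 f} & forall x, 0 <= g x <= gamma]) ->
  tietze_continuous R X.
Proof.
move=> tX; apply/tietze_continuousP => A f cA cf.
pose u x := f x / (1 + `|f x|).
have u1 x : `|u x| < 1.
  have f0 := normr_ge0 (f x).
  by rewrite /u normrM normfV (@ger0_norm _ (1 + _)) ?ltr_pdivrMr; lra.
have cu : {within A, continuous u}.
  move=> x; apply: cvgM; first exact: cf.
  apply: cvgV; first by have := normr_ge0 (f x); lra.
  by apply: cvgD; [exact: cvg_cst|exact: cvg_norm (cf x)].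
(* The bounded case concerns [[0, 2]] rather than [[-1, 1]], hence the shift. *)
have [|||g [cg gu g2]] := tX A (fun x => u x + 1) 2 cA.
- by move=> x; apply: cvgD; [exact: cu|exact: cvg_cst].
- by [].
- by move=> x; have := u1 x; rewrite ltr_norml => /andP[? ?]; lra.
pose g1 x := g x - 1.
have cg1 : continuous g1 by move=> x; apply: cvgB; [exact: cg|exact: cvg_cst].
have g1u : {in A, g1 =1 u} by move=> x /gu; rewrite /g1 => ->; lra.
have g1le x : `|g1 x| <= 1.
  by have := g2 x; rewrite /g1 ler_norml => /andP[? ?]; lra.
pose B := [set x | `|g1 x| = 1].
have cB : closed B.
  apply: (@preimage_closed _ _ (fun x => `|g1 x|) [set 1]); last exact: closed_eq.
  by move=> x _; exact: cvg_norm (cg1 x).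
have AB x : A x -> ~ B x.
  move=> /mem_set Ax; rewrite /B /= g1u// => ux1.
  by have := u1 x; rewrite ux1 ltxx.
pose h x : R := (x \in A)%:R.
have ch : {within A `|` B, continuous h}.
  apply: withinU_continuous => //.
    have h1 : {in A, (cst 1 : subspace A -> R) =1 h} by move=> x xA; rewrite /h xA.
    exact: subspace_eq_continuous h1 (@cst_continuous _ _ _).
  have h0 : {in B, (cst 0 : subspace B -> R) =1 h}.
    by move=> x /set_mem Bx; rewrite /h memNset// => /AB.
  exact: subspace_eq_continuous h0 (@cst_continuous _ _ _).
have [|k [ck kh k1]] := tX (A `|` B) h 1
    (closedU cA cB) ch ler01.
  by move=> x; rewrite /h; case: (x \in A); rewrite !(lexx, ler01).
pose p x := g1 x * k x.
have p1 x : `|p x| < 1.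
  have /andP[k0 k1x] := k1 x; rewrite /p normrM (ger0_norm k0).
  have [Bx|nBx] := pselect (B x).
    rewrite kh; last by apply/mem_set; right.
    by rewrite /h memNset ?mulr0// => /AB.
  have g1lt : `|g1 x| < 1 by rewrite lt_neqAle g1le andbT; apply/eqP.
  by apply: le_lt_trans g1lt; rewrite ler_piMr.
exists (fun x => p x / (1 - `|p x|)); split => [x|x xA].
  have cp : {for x, continuous p} by apply: cvgM; [exact: cg1|exact: ck].
  apply: cvgM => //; apply: cvgV; first by have := p1 x; lra.
  by apply: cvgB; [exact: cvg_cst|exact: cvg_norm cp].
have pu : p x = u x.
  rewrite /p g1u// kh; last by rewrite in_setU xA.
  by rewrite /h xA mulr1.
have f0 := normr_ge0 (f x).
rewrite pu /u normrM normfV (@ger0_norm _ (1 + _)); last lra.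
by field; apply/andP; split; lra.
Qed.

(** * The equivalence *)

Theorem proposition5p3 (R : realType) (X : topologicalType) :
  tietze_contractions (top_distance R X) <-> tietze_continuous R X.
Proof.
split=> [tX|]; first exact/tietze_unbounded/tietze_contractions_bounded.
exact: tietze_continuous_contractions.
Qed.
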